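(* Let $q\ge 2$ be an integer, let $(\rho_r)_{r=0}^{q-1}$ be complex numbers, and let $P^\circ=(P^\circ_{ab})_{a,b\in\mathcal V_q}$ be the $q\times q$ matrix with entries $$P^\circ_{ab}=\frac1q\sum_{r=0}^{q-1}\rho_r\,\theta_r^{a}\,\theta_r^{-b}.$$ Then $P^\circ$ is non-negative and a transition probability matrix if and only if there is a random variable $V$ with values in $\mathcal V_q$ such that $$\rho_r=\eta_r:=\mathbb E\big[\theta_r^{V}\big],\qquad r\in\mathcal V_q .$$ The probability distribution of $V$ satisfies $$\mathbb P(V=v)=\frac1q\sum_{r=0}^{q-1}\eta_r\,\theta_r^{-v},\qquad v\in\mathcal V_q .$$
   Context: $\mathcal V_q=\{0,1,\ldots,q-1\}$. For an integer $l$, $\theta_l=e^{2\pi i l/q}$ with $i=\sqrt{-1}$, so $\theta_r^a=e^{2\pi i ra/q}$. A transition probability matrix is a matrix with real non-negative entries all of whose rows sum to $1$. *)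

(* Defs.v *)
From mathcomp Require Import all_boot all_order all_algebra.
From mathcomp Require Import complex.
From mathcomp Require Import all_classical all_reals all_analysis.

Set Implicit Arguments.
Unset Strict Implicit.
Unset Printing Implicit Defensive.

Import Order.TTheory GRing.Theory Num.Theory.
Import numFieldNormedType.Exports.

Local Open Scope ring_scope.
Local Open Scope complex_scope.

(* theta R q l is e^(2 i pi l / q), through Euler's formula. *)
Definition theta (R : realType) (q : nat) (l : int) : R[i] :=
  let x : R := 2 * pi * l%:~R / q%:R in cos x +i* sin x.

(* On R[i], 0 <= z means that z is real and non-negative. *)
Definition nonneg_mx (R : realType) (m n : nat) (A : 'M[R[i]]_(m, n)) : Prop :=
  forall a b, 0 <= A a b.

Definition transition_mx (R : realType) (n : nat) (A : 'M[R[i]]_n) : Prop :=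
  nonneg_mx A /\ forall a, \sum_(b < n) A a b = 1.

Definition Pcirc (R : realType) (q : nat) (rho : 'I_q -> R[i]) : 'M[R[i]]_q :=
  \matrix_(a < q, b < q)
    (q%:R^-1 * \sum_(r < q) rho r * theta R q r ^+ a * theta R q r ^- b).

(* The real expectations are extended reals; fine loses nothing when the real
   and imaginary parts of Z are integrable, e.g. when Z is bounded. *)
Definition expectationC (R : realType) (d : measure_display)
    (T : measurableType d) (P : probability T R) (Z : T -> R[i]) : R[i] :=
  fine ('E_P[fun t => complex.Re (Z t)])%E +i*
  fine ('E_P[fun t => complex.Im (Z t)])%E.

Definition eta_ (R : realType) (d : measure_display) (T : measurableType d)
    (P : probability T R) (q : nat) (V : {RV P >-> nat}) (r : 'I_q) : R[i] :=
  expectationC P (fun t => theta R q r ^+ V t).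

(* A random variable with values in {0, ..., q - 1} is a nat-valued random
   variable (nat carries the discrete sigma-algebra) whose values are all below q. *)
Definition valued_in (R : realType) (d : measure_display)
    (T : measurableType d) (P : probability T R) (q : nat)
    (V : {RV P >-> nat}) : Prop :=
  forall t, (V t < q)%N.

(* Main.v *)
(* By orthogonality of the characters of Z/q, the vector (theta_s^b)_b is an
   eigenvector of Pcirc with eigenvalue rho_s. For s = 0 this says that every row
   of Pcirc sums to rho_0; read at row 0, it says that rho is the Fourier transform
   of that row, so if Pcirc is stochastic, V can be given row 0 as its law.
   Conversely, if rho is the Fourier transform of the law p of V, orthogonality
   gives Pcirc_ab = p_((b - a) mod q) >= 0. *)
Require Import Defs.
From HB Require Import structures.
From mathcomp Require Import all_boot all_order all_algebra.
From mathcomp Require Import complex.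
From mathcomp Require Import all_classical all_reals all_analysis.
Import Order.TTheory GRing.Theory Num.Theory.
Import numFieldNormedType.Exports.
Local Open Scope ring_scope.
Local Open Scope complex_scope.
Local Open Scope classical_set_scope.

Set Implicit Arguments.
Unset Strict Implicit.

(** The sum is geometric with ratio [z = w ^+ a / w ^+ b]. If [z = 1], every term is 1; otherwise
    [(z - 1) * sum = z ^+ q - 1 = 0] forces the sum to vanish. *)
Lemma sum_prim_root (F : fieldType) (q : nat) (w : F) (a b : nat) :
  q.-primitive_root w ->
  \sum_(r < q) (w ^+ r) ^+ a * (w ^+ r) ^- b = q%:R * (a == b %[mod q])%:R.
Proof.
move=> prim_w; have w0 : w != 0.
  by rewrite (prim_root_eq0 prim_w) -lt0n (prim_order_gt0 prim_w).
set z := w ^+ a / w ^+ b.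
have -> : \sum_(r < q) (w ^+ r) ^+ a * (w ^+ r) ^- b = \sum_(r < q) z ^+ r.
  apply: eq_bigr => r _.
  by rewrite expr_div_n -!exprM ![(r * _)%N]mulnC.
have [eq_ab|neq_ab] := boolP (a == b %[mod q]).
  move: eq_ab; rewrite -(eq_prim_root_expr prim_w) => /eqP eq_ab.
  rewrite mulr1 /z eq_ab divff ?expf_neq0 //.
  under eq_bigr do rewrite expr1n.
  by rewrite sumr_const card_ord.
rewrite mulr0; apply/eqP.
have : z ^+ q - 1 == 0.
  rewrite expr_div_n -!exprM ![(_ * q)%N]mulnC !exprM.
  by rewrite (prim_expr_order prim_w) !expr1n divr1 subrr.
rewrite subrX1 mulf_eq0 subr_eq0 => /orP[/eqP z1|//].
case/negP: neq_ab; rewrite -(eq_prim_root_expr prim_w).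
by rewrite -[w ^+ a](divfK (expf_neq0 b w0)) -/z z1 mul1r.
Qed.

Lemma thetaD (R : realType) (q : nat) (l m : int) :
  theta R q (l + m) = theta R q l * theta R q m.
Proof.
rewrite /theta intrD mulrDr mulrDl cosD sinD.
by rewrite [X in _ +i* X]addrC.
Qed.

Lemma theta0 (R : realType) (q : nat) : theta R q 0 = 1.
Proof. by rewrite /theta mulr0 mul0r cos0 sin0. Qed.

Lemma theta_nat (R : realType) (q n : nat) : theta R q n = theta R q 1 ^+ n.
Proof.
elim: n => [|n IHn]; first by rewrite theta0.
by rewrite -[in LHS]addn1 PoszD thetaD IHn exprSr.
Qed.

Lemma theta_prim_root (R : realType) (q : nat) : (0 < q)%N ->
  q.-primitive_root (theta R q 1).
Proof.
move=> q0; have q0' : (0 : R) < q%:R by rewrite ltr0n.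
rewrite /primitive_root_of_unity q0; apply/forallP => /= i.
rewrite unity_rootE -theta_nat.
have [->|niq] := eqVneq i.+1 q.
  rewrite /theta -[(q%:Z)%:~R]/(q%:R) mulfK ?(gt_eqF q0') //.
  by rewrite mulr_natl cos2pi sin2pi !eqxx.
have ltiq : (i.+1 < q)%N by rewrite ltn_neqAle niq ltn_ord.
(* The real part already differs from 1: with [y] half the angle, cos(2y) = 1 - 2 sin(y)^2, and sin
   y > 0 because 0 < y < pi. *)
apply/eqP/negbTE; rewrite eq_complex negb_and; apply/orP; left => /=.
pose y : R := pi * i.+1%:R / q%:R.
have -> : 2 * pi * (i.+1%:Z)%:~R / q%:R = y *+ 2.
  by rewrite -[RHS]mulr_natl /y -!mulrA.
rewrite cos_mulr2n.
have y_gt0 : 0 < sin y.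
  apply: sin_gt0_pi; rewrite /y divr_gt0 ?mulr_gt0 ?pi_gt0 ?ltr0n //=.
  by rewrite -mulrA gtr_pMr ?pi_gt0 // ltr_pdivrMr // mul1r ltr_nat.
rewrite cos2sin2 mulrnBl -subr_eq0 [X in X == 0](_ : _ = - (sin y ^+ 2 *+ 2)).
  by rewrite oppr_eq0 mulrn_eq0 /= sqrf_eq0 gt_eqF.
by rewrite -addrA -opprD -mulr2n addrAC subrr add0r.
Qed.

(** As V has finitely many values, [g (V t)] is a finite combination of indicators of the events V =
    u, which can be integrated term by term. *)
Lemma expectation_valued_in (R : realType) (d : measure_display)
    (T : measurableType d) (P : probability T R) (q : nat)
    (V : {RV P >-> nat}) (g : nat -> R) : valued_in q V ->
  ('E_P[fun t => g (V t)] =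
   (\sum_(u < q) fine (distribution P V [set (u : nat)]) * g u)%R%:E)%E.
Proof.
move=> Vq; rewrite unlock.
have mV u : measurable (V @^-1` [set u]).
  by rewrite -[X in measurable X]setTI; exact: measurable_funP.
rewrite [LHS](_ : _ = (\int[P]_t \sum_(u < q)
    (g u)%:E * (\1_(V @^-1` [set (u : nat)]) t)%:E)%E).
  rewrite integral_sum //; last first.
    move=> u; apply: integrableZl => //; exact: integrable_indic.
  rewrite -sumEFin; apply: eq_bigr => u _.
  rewrite integralZl //; last exact: integrable_indic.
  rewrite integral_indic // setIT EFinM muleC fineK //.
  exact: fin_num_measure.
apply: eq_integral => t _.
rewrite (bigD1 (Ordinal (Vq t))) //= big1 ?adde0.
  by rewrite indicE mem_set // mule1.
move=> u ut; rewrite indicE memNset ?mule0 //= => Vt.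
by case/eqP: ut; exact/val_inj.
Qed.

(** Exhibits [eta_] as the Fourier transform of the law of V, the form that [Pcirc_dft] takes as
    hypothesis. The real and imaginary parts are computed separately. *)
Lemma eta_sum (R : realType) (d : measure_display)
    (T : measurableType d) (P : probability T R) (q : nat)
    (V : {RV P >-> nat}) (r : 'I_q) : valued_in q V ->
  eta_ V r =
  \sum_(u < q) (fine (distribution P V [set (u : nat)]))%:C * theta R q r ^+ u.
Proof.
move=> Vq; rewrite /eta_ /expectationC.
rewrite (@expectation_valued_in _ _ _ P _ V
  (fun u => complex.Re (theta R q r ^+ u)) Vq).
rewrite (@expectation_valued_in _ _ _ P _ V
  (fun u => complex.Im (theta R q r ^+ u)) Vq) /=.
have sumC (n : nat) (f h : 'I_n -> R) :
  (\sum_i f i) +i* (\sum_i h i) = \sum_i (f i +i* h i) :> R[i].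
  elim: n f h => [|n IHn] f h; first by rewrite !big_ord0.
  by rewrite !big_ord_recr /= -IHn.
rewrite sumC; apply: eq_bigr => u _.
case: (theta R q r ^+ u) => x y /=.
by apply/eqP; rewrite eq_complex /= !mul0r subr0 addr0 !eqxx.
Qed.

Lemma sum_distribution (R : realType) (d : measure_display)
    (T : measurableType d) (P : probability T R) (q : nat)
    (V : {RV P >-> nat}) : valued_in q V ->
  \sum_(u < q) fine (distribution P V [set (u : nat)]) = 1.
Proof.
move=> Vq; apply: EFin_inj.
have := @expectation_valued_in _ _ _ P _ V (fun=> 1) Vq.
by rewrite expectation_cst => ->; under [in RHS]eq_bigr do rewrite mulr1.
Qed.

Lemma exists_RV_nat (R : realType) (q : nat) (p : 'I_q -> R) : (0 < q)%N ->
  (forall v, 0 <= p v) -> \sum_(v < q) p v = 1 ->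
  exists (P : probability nat R) (V : {RV P >-> nat}), valued_in q V /\
  forall v : 'I_q, distribution P V [set (v : nat)] = (p v)%:E.
Proof.
move=> q0 p0 p1.
(* A mixture of Dirac masses. [msum] wants a sequence indexed by [nat], so [p] is extended by
   [insubd]; its default value is never reached, since only indices below q are summed. *)
pose mu := msum (fun v => mscale (NngNum (p0 (insubd (Ordinal q0) v)))
  (\d_v : {measure set nat -> \bar R})) q.
have muE A : mu A = (\sum_(v < q) p v * \1_A (v : nat))%:E.
  rewrite /mu /msum -sumEFin; apply: eq_bigr => v _.
  by rewrite /mscale /= valKd.
have mu1 : mu setT = 1%E.
  rewrite muE; congr EFin; rewrite -[RHS]p1; apply: eq_bigr => v _.
  by rewrite indicT mulr1.
pose m := Measure_isProbability.Build _ _ _ mu mu1.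
pose P : probability nat R := HB.pack mu m.
(* The identity has the same law, but is below q only almost everywhere. *)
have mV : measurable_fun [set: nat] (fun t => t %% q)%N by [].
pose v := isMeasurableFun.Build _ _ _ _ (fun t => t %% q)%N mV.
pose V : {RV P >-> nat} := HB.pack (fun t => t %% q)%N v.
exists P, V; split=> [t|u]; first exact: ltn_pmod.
rewrite /distribution /pushforward /= muE; congr EFin.
rewrite (bigD1 u) //= big1 ?addr0.
  by rewrite indicE mem_set ?mulr1 //= modn_small.
move=> w wu; rewrite indicE memNset ?mulr0 //= modn_small // => /val_inj wu'.
by rewrite wu' eqxx in wu.
Qed.

Lemma Pcirc_eigen (R : realType) (q : nat) (rho : 'I_q -> R[i]) (a s : 'I_q) :
  \sum_(b < q) Pcirc rho a b * theta R q s ^+ b = rho s * theta R q s ^+ a.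
Proof.
have q0 : (0 < q)%N by case: q a {s rho} => // -[].
have prim_w := theta_prim_root R q0.
have qn0 : q%:R != 0 :> R[i] by rewrite pnatr_eq0 -lt0n.
(* Here the sum runs over the exponent b. Rewriting theta_r^b as (theta_1^b)^r swaps index and
   exponent, so that orthogonality applies to the inner sum. *)
transitivity (\sum_(r < q) q%:R^-1 * (rho r * theta R q r ^+ a) *
    \sum_(b < q) (theta R q 1 ^+ b) ^+ s * (theta R q 1 ^+ b) ^- r).
  under eq_bigr do rewrite mxE mulr_sumr mulr_suml.
  rewrite exchange_big /=; apply: eq_bigr => r _.
  rewrite mulr_sumr; apply: eq_bigr => b _.
  rewrite -!mulrA; do 3 congr (_ * _).
  rewrite mulrC (theta_nat R q r) (theta_nat R q s) -!exprM.
  by rewrite ![(b * _)%N]mulnC.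
under eq_bigr do rewrite (sum_prim_root _ _ prim_w) !modn_small //.
rewrite (bigD1 s) //= big1 ?addr0 => [|r rs].
  by rewrite eqxx mulr1 mulrC mulVKf.
by rewrite eq_sym (inj_eq val_inj) (negbTE rs) !mulr0.
Qed.

(** Orthogonality, now summed over r, keeps only u congruent to b - a mod q. Stating this as a sum
    with a congruence makes non-negativity termwise, and row 0 gives Fourier inversion. *)
Lemma Pcirc_dft (R : realType) (q : nat) (rho p : 'I_q -> R[i]) (a b : 'I_q) :
  (forall r, rho r = \sum_(u < q) p u * theta R q r ^+ u) ->
  Pcirc rho a b = \sum_(u < q) p u * (u + a == b %[mod q])%:R.
Proof.
move=> rhoE; have q0 : (0 < q)%N by case: q a {b rho p rhoE} => // -[].
have prim_w := theta_prim_root R q0.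
have qn0 : q%:R != 0 :> R[i] by rewrite pnatr_eq0 -lt0n.
rewrite mxE mulr_sumr.
under eq_bigr do rewrite rhoE !mulr_suml mulr_sumr.
rewrite exchange_big /=; apply: eq_bigr => u _.
transitivity (p u * (q%:R^-1 * \sum_(r < q)
    (theta R q 1 ^+ r) ^+ (u + a) * (theta R q 1 ^+ r) ^- b)).
  rewrite !mulr_sumr; apply: eq_bigr => r _.
  by rewrite theta_nat exprD -!mulrA mulrCA.
by rewrite (sum_prim_root _ _ prim_w) mulKf.
Qed.

Theorem proposition1 (R : realType) (q : nat) (hq : (2 <= q)%N)
    (rho : 'I_q -> R[i]) :
  (nonneg_mx (Pcirc rho) /\ transition_mx (Pcirc rho) <->
   exists (d : measure_display) (T : measurableType d) (P : probability T R)
     (V : {RV P >-> nat}),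
     valued_in q V /\ forall r : 'I_q, rho r = eta_ V r) /\
  (forall (d : measure_display) (T : measurableType d) (P : probability T R)
     (V : {RV P >-> nat}),
     valued_in q V ->
     forall v : 'I_q,
       (fine (distribution P V [set (v : nat)]))%:C =
       q%:R^-1 * \sum_(r < q) eta_ V r * theta R q r ^- v).
Proof.
have q0 : (0 < q)%N by exact: leq_trans hq.
pose o : 'I_q := Ordinal q0.
have row_sum a : \sum_(b < q) Pcirc rho a b = rho o.
  transitivity (rho o * theta R q o ^+ a); last by rewrite theta0 expr1n mulr1.
  by rewrite -Pcirc_eigen; apply: eq_bigr => b _; rewrite theta0 expr1n mulr1.
split; [split=> [[P_ge0 [_ P_sum]]|[d [T [P [V [Vq rhoE]]]]]]|].
(* A non-negative element of [R[i]] is real, so row 0 is a genuine real probability vector. *)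
- pose p v := complex.Re (Pcirc rho o v).
  have pE v : Pcirc rho o v = (p v)%:C by rewrite RRe_real // ger0_real.
  have p_ge0 v : 0 <= p v by rewrite -lecR -pE.
  have p_sum : \sum_(v < q) p v = 1.
    apply: complexI; rewrite rmorph_sum /= rmorph1 -(P_sum o).
    by apply: eq_bigr => v _; rewrite -pE.
  have [P [V [Vq VE]]] := exists_RV_nat q0 p_ge0 p_sum.
  exists _, _, P, V; split=> // r.
  have := Pcirc_eigen rho o r; rewrite expr0 mulr1 => <-.
  by rewrite eta_sum //; apply: eq_bigr => v _; rewrite VE pE.
- have {}rhoE r : rho r = _ := etrans (rhoE r) (eta_sum r Vq).
  have P_ge0 : nonneg_mx (Pcirc rho).
    move=> a b; rewrite (Pcirc_dft _ _ rhoE); apply: sumr_ge0 => u _.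
    by rewrite mulr_ge0 ?ler0n // ler0c fine_ge0.
  split=> //; split=> // a; rewrite row_sum rhoE.
  under eq_bigr do rewrite theta0 expr1n mulr1.
  by rewrite -rmorph_sum /= sum_distribution // rmorph1.
move=> d T P V Vq v.
(* The right-hand side is entry (0, v) of [Pcirc] built from [eta_ V]; in row 0 the congruence
   between numbers below q reduces to u = v. *)
have := Pcirc_dft o v (fun r => eta_sum r Vq); rewrite mxE.
under eq_bigr do rewrite expr0 mulr1.
move=> ->; rewrite (bigD1 v) //= big1 ?addr0 => [|u uv].
  by rewrite addn0 eqxx mulr1.
by rewrite addn0 !modn_small // (inj_eq val_inj) (negbTE uv) mulr0.
Qed.
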